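(* For all integers $m,n\ge1$, \[ \mathcal{U}_0(\mathrm{CLF}(m,n),L_{\mathrm{std}},\mathbb{Q}/\mathbb{Z})\cong \begin{cases} (\mathbb{Z}/2)^n, & m\text{ odd},\\ (\mathbb{Z}/2)^{2n}, & m\equiv2\pmod 4,\\ \left(\bigoplus_{j=1}^n\mathbb{Z}/\gcd(4^j,2m)\right)^{\oplus2}, & m\equiv0\pmod4. \end{cases} \]
   Context: $\mathrm{CLF}(m,n)$ is the multigraph with boundary with vertex set $V=(\mathbb{Z}/m)\times\{0,\dots,n\}$, boundary vertices $\partial V=(\mathbb{Z}/m)\times\{0\}$ (all other vertices are interior), and the following undirected edges, counted with multiplicity: for each $j\in\mathbb{Z}/m$ and $1\le k\le n$, one edge joining $(j,k)$ to $(j+1,n-k+1)$; and for each $j\in\mathbb{Z}/m$ and $0\le k\le n$, one edge joining $(j,k)$ to $(j+1,n-k)$. The standard Laplacian acts on functions $u:V\to\mathbb{Q}/\mathbb{Z}$ by $L_{\mathrm{std}}u(x)=\sum_{e}(u(x)-u(e_-))$, the sum over all oriented edges $e$ starting at $x$, where $e_-$ is the end of $e$. $\mathcal{U}_0(\mathrm{CLF}(m,n),L_{\mathrm{std}},\mathbb{Q}/\mathbb{Z})$ is the abelian group of functions $u:V\to\mathbb{Q}/\mathbb{Z}$ with $L_{\mathrm{std}}u=0$ on all of $V$ and $u=0$ on $\partial V$. *)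

(* Defs.v *)
From HB Require Import structures.
From mathcomp Require Import all_boot all_order all_algebra.

Set Implicit Arguments.
Unset Strict Implicit.
Unset Printing Implicit Defensive.

Import Order.TTheory GRing.Theory Num.Theory.
Local Open Scope ring_scope.

(* [ends e] lists the two endpoints in an arbitrary reference order; loops and
   parallel edges are allowed. *)
Record bmgraph := BMGraph {
  vertex : finType;
  edge : finType;
  ends : edge -> vertex * vertex;
  boundary : {set vertex}
}.

(* Each undirected edge, loops included, carries two orientations. *)
Definition oedge (G : bmgraph) : finType := (edge G * bool)%type.

Definition ostart (G : bmgraph) (e : oedge G) : vertex G :=
  if e.2 then (ends e.1).1 else (ends e.1).2.

Definition oend (G : bmgraph) (e : oedge G) : vertex G :=
  if e.2 then (ends e.1).2 else (ends e.1).1.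

Definition Lstd (G : bmgraph) (M : zmodType) (u : {ffun vertex G -> M}) :
    {ffun vertex G -> M} :=
  [ffun x => \sum_(e : oedge G | ostart e == x) (u x - u (oend e))].

Section HarmonicFunctions.
Variables (G : bmgraph) (M : zmodType).

Definition U0_pred : {pred {ffun vertex G -> M}} :=
  fun u => [forall x, Lstd u x == 0] && [forall x in boundary G, u x == 0].

Fact U0_zmod_closed : zmod_closed U0_pred.
Proof.
split=> [|u v /andP[/forallP Lu /forall_inP u0] /andP[/forallP Lv /forall_inP v0]];
  apply/andP; split.
- by apply/forallP => x; rewrite ffunE big1 // => e _; rewrite !ffunE subr0.
- by apply/forall_inP => x _; rewrite ffunE.
- apply/forallP => x; have /eqP := Lu x; have /eqP := Lv x; rewrite !ffunE => Hv Hu.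
  rewrite -[X in _ == X](subr0 0) -[X in _ == X - _]Hu -[X in _ == _ - X]Hv -sumrB.
  apply/eqP/eq_bigr => e _; rewrite !ffunE.
  by rewrite !opprD !opprK addrACA.
- by apply/forall_inP => x xb; rewrite !ffunE (eqP (u0 x xb)) (eqP (v0 x xb)) subr0.
Qed.

HB.instance Definition _ :=
  GRing.isZmodClosed.Build {ffun vertex G -> M} U0_pred U0_zmod_closed.

Record U0 := MkU0 { U0_val :> {ffun vertex G -> M}; _ : U0_val \in U0_pred }.

HB.instance Definition _ := [isSub for U0_val].
HB.instance Definition _ := [Choice of U0 by <:].
HB.instance Definition _ := [SubChoice_isSubZmodule of U0 by <:].

End HarmonicFunctions.

(* ['I_m] with the cyclic successor [ordS] stands for Z/m: unlike ['Z_m], it is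
   right also for m = 1.  An index [k : 'I_n] of the first family stands for
   1 <= k.+1 <= n, and [lift ord0 (rev_ord k)] has value
   (n - k.+1).+1 = n - k.+1 + 1; [rev_ord k] in the second has value n - k. *)
Definition CLF_ends (m n : nat) (e : 'I_m * 'I_n + 'I_m * 'I_n.+1) :
    ('I_m * 'I_n.+1) * ('I_m * 'I_n.+1) :=
  match e with
  | inl (j, k) => ((j, lift ord0 k), (ordS j, lift ord0 (rev_ord k)))
  | inr (j, k) => ((j, k), (ordS j, rev_ord k))
  end.

Definition CLF (m n : nat) : bmgraph :=
  @BMGraph ('I_m * 'I_n.+1)%type ('I_m * 'I_n + 'I_m * 'I_n.+1)%type
    (@CLF_ends m n) [set x | x.2 == ord0].

(* The additive group Q/Z.  [Num.int_num_subdef] is the predicate underlying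
   [Num.int], and the one carrying the subgroup structure. *)
Definition QZ : zmodType := {ideal_quot (Num.int_num_subdef : {pred rat})}.

(* The library makes non-dependent finite functions into a Z-module, but not
   dependent ones. *)
Section DirectSum.
Variables (I : finType) (A : I -> zmodType).

Definition dirsum := {dffun forall i : I, A i}.
HB.instance Definition _ := Choice.on dirsum.

Definition dirsum_zero : dirsum := [ffun i => 0 : A i].
Definition dirsum_opp (f : dirsum) : dirsum := [ffun i => - f i].
Definition dirsum_add (f g : dirsum) : dirsum := [ffun i => f i + g i].

Fact dirsum_addA : associative dirsum_add.
Proof. by move=> f g h; apply/ffunP=> i; rewrite !ffunE addrA. Qed.
Fact dirsum_addC : commutative dirsum_add.
Proof. by move=> f g; apply/ffunP=> i; rewrite !ffunE addrC. Qed.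
Fact dirsum_add0 : left_id dirsum_zero dirsum_add.
Proof. by move=> f; apply/ffunP=> i; rewrite !ffunE add0r. Qed.
Fact dirsum_addN : left_inverse dirsum_zero dirsum_opp dirsum_add.
Proof. by move=> f; apply/ffunP=> i; rewrite !ffunE addNr. Qed.

HB.instance Definition _ := GRing.isZmodule.Build dirsum
  dirsum_addA dirsum_addC dirsum_add0 dirsum_addN.

End DirectSum.

Definition zmod_isog (U V : zmodType) : Prop :=
  exists f : {additive U -> V}, bijective f.

(* Main.v *)
Require Import Defs.
From HB Require Import structures.
From mathcomp Require Import all_boot all_order all_algebra.
From mathcomp Require Import zify ring.

(** Write u_i for the i-th column of u, a function on Z/m, and s for the sum of the two
    translates of such a function.  Harmonicity with zero boundary values says that
    u_0 = 0, s u_n = 0 and s (u_(i+1) + u_i) = 4 u_(n-i) for i < n.  Along the walk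
    0, n, 1, n-1, 2, ... this is a chain, and in terms of the sequence w obtained by
    reading the walk backwards it becomes s (w_k + w_(k+2)) = 4 w_(k+1) together with a
    boundary condition at k = 0.  Let D be the shift of sequences; D is locally
    nilpotent on finitely supported sequences, so 1 + D^2 and 1 - D are invertible.
    Put z = (1 - D) (1 + D^2)^-1 w and B = D (1 + D^2)^-1; the equations become
    4 z_0 = 0 and s z = 4 B z, and the values x_i = (B^i z)_0 satisfy the
    triangular system 4 x_0 = 0, s x_i = 4 x_(i+1), with x_i = 0 for i >= n.  The
    change of unknowns from u to x is invertible over the integers ([reduce_system],
    [reduce_inj], [reduce_surj]).

    Unrolled along Z/m, a solution is an array X of rows X_0, ..., X_(n-1) with
    X_k (j+2) + X_k j = 4 X_(k+1) (j+1), 4 X_0 = 0 and period m in j.  It is determined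
    by X_k 0 and X_k 1, it satisfies 4^(k+1) X_k = 0, and only the periodicity remains
    to be understood.  If S raises the row and T is the translation, then
    T^4 - 1 = 8 S T^2 (T - 2 S) ([shift4]), and an induction on e shows that X has
    period 4 * 2^e exactly when 8 * 2^e X_k = 0 for all k >= 1 ([periodic_pow2]).
    As X is killed by 4^n, it has some period 4 * 2^e, hence the period
    gcd (m, 4 * 2^e).  This gcd is 1 for m odd and 2 for m = 2 mod 4, and then 2 X = 0,
    so that the coordinates are n, respectively 2n, arbitrary elements of order at
    most 2.  For 4 | m the period m amounts to 2m X_k = 0 for k >= 1
    ([periodic_iff]); together with 4^(k+1) X_k = 0 this leaves for each of X_k 0 and
    X_k 1 the elements of Q/Z killed by gcd (4^(k+1), 2m). *)

Set Implicit Arguments.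
Unset Strict Implicit.
Unset Printing Implicit Defensive.

Import Order.TTheory GRing.Theory Num.Theory.
Local Open Scope ring_scope.

(** * Torsion of Q/Z *)

(** The class in Q/Z of a rational number. *)
Definition toQZ (q : rat) : QZ := (\pi_QZ q)%qT.

Lemma toQZ_eq (p q : rat) : (toQZ p == toQZ q) = (p - q \is a Num.int).
Proof. by rewrite /toQZ -Quotient.idealrBE. Qed.

Lemma toQZD (p q : rat) : toQZ (p + q) = toQZ p + toQZ q.
Proof. by rewrite /toQZ [LHS]Quotient.pi_add. Qed.

Lemma toQZ_surj (q : QZ) : exists r, toQZ r = q.
Proof. by exists (repr q); rewrite /toQZ reprK. Qed.

Lemma toQZ0 : toQZ 0 = 0.
Proof. by apply: (@addrI _ (toQZ 0)); rewrite -toQZD !addr0. Qed.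

Lemma toQZMn (q : rat) (d : nat) : toQZ (q *+ d) = toQZ q *+ d.
Proof. by elim: d => [|d IH]; rewrite ?toQZ0 // !mulrS toQZD IH. Qed.

(** The embedding of Z/d in Q/Z that sends 1 to 1/d. *)
Definition iota_QZ (d : nat) (c : 'Z_d) : QZ := toQZ ((c : nat)%:R / d%:R).

Section Iota.
Variables (d : nat) (d_gt1 : (1 < d)%N).

Let d_neq0 : d%:R != 0 :> rat.
Proof. by rewrite pnatr_eq0; lia. Qed.

Lemma iota_QZD (a b : 'Z_d) : iota_QZ (a + b) = iota_QZ a + iota_QZ b.
Proof.
have val_ab : nat_of_ord (a + b) = ((a + b) %% d)%N.
  by congr (_ %% _)%N; exact: Zp_cast.
rewrite /iota_QZ -toQZD; apply/eqP; rewrite toQZ_eq val_ab.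
set c := (a + b)%N.
have -> : (c %% d)%:R / d%:R - (a%:R / d%:R + b%:R / d%:R) = - (c %/ d)%:R :> rat.
  have E : c%:R = (c %/ d)%:R * d%:R + (c %% d)%:R :> rat.
    by rewrite -natrM -natrD -divn_eq.
  apply: (mulIf d_neq0); rewrite !mulrBl !mulrDl !divfK //.
  by rewrite -natrD -/c E; ring.
by rewrite rpredN natr_int.
Qed.

Lemma iota_QZB (a b : 'Z_d) : iota_QZ (a - b) = iota_QZ a - iota_QZ b.
Proof. by apply: (@addIr _ (iota_QZ b)); rewrite -iota_QZD !subrK. Qed.

Lemma iota_QZ_inj : injective (@iota_QZ d).
Proof.
move=> a b /eqP; rewrite toQZ_eq -mulrBl => /intrP[z E].
have {}E : (a%:Z - b%:Z) = z * d%:Z.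
  apply: (@intr_inj rat); rewrite rmorphM rmorphB /= -!pmulrn -E.
  by rewrite divfK.
have ha := ltn_ord a; have hb := ltn_ord b.
have dE : (Zp_trunc d).+2 = d by exact: Zp_cast.
apply: val_inj => /=; move: (nat_of_ord a) (nat_of_ord b) ha hb E.
rewrite dE => x y ha hb E; have [z_lt0|z_gt0|z0] := ltrgtP z 0; nia.
Qed.

Lemma iota_QZ_torsion (a : 'Z_d) : iota_QZ a *+ d = 0.
Proof.
rewrite -toQZMn -[X in toQZ X]mulr_natr divfK //; apply/eqP.
by rewrite -toQZ0 toQZ_eq subr0 natr_int.
Qed.

Lemma iota_QZ_onto (q : QZ) : q *+ d = 0 -> exists a : 'Z_d, iota_QZ a = q.
Proof.
have [r <-] := toQZ_surj q; rewrite -toQZMn -toQZ0 => /eqP.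
rewrite toQZ_eq subr0 => /intrP[z E].
have dz : (d%:Z != 0) by lia.
have hr : (`|(z %% d%:Z)%Z|%N < d)%N.
  by have := ltz_pmod z (_ : 0 < d%:Z); have := modz_ge0 z dz; lia.
exists (inZp `|(z %% d%:Z)%Z|%N); apply/eqP; rewrite toQZ_eq /=.
rewrite Zp_cast // modn_small //.
have -> : r = z%:~R / d%:R by rewrite -E -[X in X / _]mulr_natr mulfK.
rewrite -mulrBl [X in (X - _) / _]pmulrn gez0_abs ?modz_ge0 //.
rewrite -rmorphB /= [X in X%:~R](_ : _ = - (z %/ d%:Z)%Z * d%:Z); last first.
  by rewrite [in X in _ - X](divz_eq z d); ring.
by rewrite rmorphM /= -pmulrn mulfK // intr_int.
Qed.

End Iota.

(** V has coordinates phi in Q/Z, W has coordinates pi in the groups Z/d_i.  If phi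
    identifies V with all families whose i-th entry is killed by d_i, and pi identifies
    W with the product of the Z/d_i, then V and W are isomorphic. *)
Lemma isog_coord (V W : zmodType) (I : finType) (d : I -> nat)
    (phi : V -> I -> QZ) (pi : forall i, W -> 'Z_(d i)) :
    (forall i, 1 < d i)%N ->
    (forall u v i, phi (u - v) i = phi u i - phi v i) ->
    (forall u, (forall i, phi u i = 0) -> u = 0) ->
    (forall u i, phi u i *+ d i = 0) ->
    (forall q : I -> QZ, (forall i, q i *+ d i = 0) ->
       exists u, forall i, phi u i = q i) ->
    (forall u v i, pi i (u - v) = pi i u - pi i v) ->
    (forall w, (forall i, pi i w = 0) -> w = 0) ->
    (forall c : forall i, 'Z_(d i), exists w, forall i, pi i w = c i) ->
  zmod_isog V W.
Proof.
move=> d_gt1 phiB phi_inj phi_tor phi_onto piB pi_inj pi_onto.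
have ex_f (u : V) : exists w, [forall i, iota_QZ (pi i w) == phi u i].
  have c_ex i : exists a : 'Z_(d i), iota_QZ a == phi u i.
    by have [a <-] := iota_QZ_onto (d_gt1 i) (phi_tor u i); exists a.
  have [w Hw] := pi_onto (fun i => xchoose (c_ex i)).
  by exists w; apply/forallP => i; rewrite Hw; exact: (xchooseP (c_ex i)).
pose f u := xchoose (ex_f u).
have fP u i : iota_QZ (pi i (f u)) = phi u i.
  by have /forallP/(_ i)/eqP := xchooseP (ex_f u).
have eq_coord w w' : (forall i, pi i w = pi i w') -> w = w'.
  by move=> E; apply/eqP; rewrite -subr_eq0; apply/eqP/pi_inj => i;
    rewrite piB E subrr.
have fB : {morph f : u v / u - v}.
  move=> u v; apply: eq_coord => i; apply: (iota_QZ_inj (d_gt1 i)).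
  by rewrite piB iota_QZB // !fP phiB.
have ex_g (w : W) : exists u, f u == w.
  have [|u Hu] := phi_onto (fun i => iota_QZ (pi i w)).
    by move=> i; exact: (iota_QZ_torsion (d_gt1 i)).
  exists u; apply/eqP/eq_coord => i; apply: (iota_QZ_inj (d_gt1 i)).
  by rewrite fP Hu.
pose fM := GRing.isZmodMorphism.Build V W f fB.
exists (HB.pack f fM : {additive V -> W}); exists (fun w => xchoose (ex_g w)).
  move=> u; apply/eqP; rewrite -subr_eq0; apply/eqP/phi_inj => i.
  have /eqP E := xchooseP (ex_g (f u)).
  by rewrite phiB -!fP [f (xchoose _)]E subrr.
by move=> w; apply/eqP/(xchooseP (ex_g w)).
Qed.

(** * The triangular change of unknowns *)

Lemma subrACA (V : zmodType) (a b c d : V) :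
  a - b - (c - d) = a - c - (b - d).
Proof. by rewrite !opprD addrACA. Qed.

(** Induction from large k down to 0. *)
Lemma descending_ind (P : nat -> Prop) (n : nat) :
    (forall k, (n <= k)%N -> P k) ->
    (forall k, (forall j, (k < j)%N -> P j) -> P k) ->
  forall k, P k.
Proof.
move=> P_large P_step k; have [c le_c] := ubnP (n - k)%N.
elim: c k le_c => [|c IH] k le_c; first by lia.
have [|lt_kn] := leqP n k; first exact: P_large.
by apply: P_step => j lt_kj; have [/P_large//|lt_jn] := leqP n j; apply: IH; lia.
Qed.

(** In the walk 0, n, 1, n-1, 2, ... through the indices 0, ..., n, the index n - i is
    adjacent to i and i + 1, as in the equations of the graph.  [fold_index n k] is the
    index at position n - k of this walk, and [unfold_index n i] the distance of i from
    its end. *)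
Definition fold_index n k := if odd (n - k) then (n + k).+1./2 else (n - k)./2.
Definition unfold_index n i := (if i.*2 <= n then n - i.*2 else i.*2 - n.+1)%N.

Lemma fold_indexP n k : (k <= n)%N ->
  ((fold_index n k).*2 = n - k \/ (fold_index n k).*2 = (n + k).+1)%N.
Proof. by rewrite /fold_index; case: ifP => odd_nk le_kn; lia. Qed.

Lemma unfold_indexP n i :
  (i.*2 <= n /\ unfold_index n i = n - i.*2 \/ n < i.*2 /\ unfold_index n i = i.*2 - n.+1)%N.
Proof. by rewrite /unfold_index; case: leqP; lia. Qed.

Lemma fold_indexK n k : (k <= n)%N -> unfold_index n (fold_index n k) = k.
Proof.
move=> le_kn; have := fold_indexP le_kn.
by have := unfold_indexP n (fold_index n k); lia.
Qed.

Lemma unfold_index_le n i : (i <= n)%N -> (unfold_index n i <= n)%N.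
Proof. by have := unfold_indexP n i; lia. Qed.

Lemma unfold_indexK n i : (i <= n)%N -> fold_index n (unfold_index n i) = i.
Proof.
move=> le_in; have := fold_indexP (unfold_index_le le_in).
by have := unfold_indexP n i; lia.
Qed.

Lemma fold_index_le n k : (k <= n)%N -> (fold_index n k <= n)%N.
Proof. by move=> le_kn; have := fold_indexP le_kn; lia. Qed.

(** The neighbours of n - i along the walk are i and i + 1; the first alternative is the
    last index of the walk, which is its own second neighbour. *)
Lemma unfold_neighbours n i : (i < n)%N ->
  let k := unfold_index n (n - i) in let a := unfold_index n i in
  let b := unfold_index n i.+1 in
  [\/ k = 0 /\ (a = 1 /\ b = 0 \/ a = 0 /\ b = 1),
      0 < k /\ a = k.-1 /\ b = k.+1
    | 0 < k /\ a = k.+1 /\ b = k.-1 ]%N.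
Proof.
move=> lt_in /=; have := unfold_indexP n i; have := unfold_indexP n i.+1.
have := unfold_indexP n (n - i).
move: (unfold_index n (n - i)) (unfold_index n i) (unfold_index n i.+1).
move=> k a b Hk Hb Ha.
have [k0|k_gt0] := posnP k.
  by constructor 1; split=> //; lia.
have [le_in|gt_in] := leqP (i.*2) n; [constructor 3|constructor 2]; split=> //; split; lia.
Qed.

Lemma fold_index_lt n k : (k < n)%N -> (0 < fold_index n k)%N.
Proof. by move=> lt_kn; have := fold_indexP (ltnW lt_kn); lia. Qed.

Section FiniteSequences.
Variable A : zmodType.
Implicit Types (w z x : nat -> A) (n N k i : nat).

Definition supported n w := forall k, (n <= k)%N -> w k = 0.

Lemma supported_le n N w : (n <= N)%N -> supported n w -> supported N w.
Proof. by move=> le_nN w0 k le_Nk; apply: w0; lia. Qed.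

Lemma add_shift2_eq0 n w :
  supported n w -> (forall k, w k + w k.+2 = 0) -> forall k, w k = 0.
Proof.
move=> w_supp E; apply: (descending_ind w_supp) => k IH.
by rewrite -[LHS]addr0 -{1}(IH k.+2) ?E.
Qed.

(** With D the shift of sequences, [alt N w] is the sum of the first N terms of the
    expansion of (1 + D^2)^-1 w.  It is the exact inverse when w is supported below N. *)
Fixpoint alt N w k := if N is N'.+1 then w k - alt N' w k.+2 else 0.

Lemma alt_supported n N w : supported n w -> supported n (alt N w).
Proof.
move=> w_supp; elim: N => [|N IH] k le_nk //=.
by rewrite w_supp // IH ?subrr //; lia.
Qed.

Lemma altS n N w k :
  supported n w -> (n <= k + N)%N -> alt N.+1 w k = alt N w k.
Proof.
move=> w_supp; elim: N k => [|N IH] k le_n.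
  by rewrite /= subr0 w_supp //; lia.
change (w k - alt N.+1 w k.+2 = w k - alt N w k.+2).
by rewrite IH //; lia.
Qed.

Lemma altK N w k : supported N w -> alt N w k + alt N w k.+2 = w k.
Proof.
by move=> w_supp; rewrite -(@altS N N _ k w_supp) ?leq_addl //= subrK.
Qed.

Lemma eq_alt N w w' k : w =1 w' -> alt N w k = alt N w' k.
Proof. by move=> E; elim: N k => //= N IH k; rewrite E IH. Qed.

Lemma alt_map (h : {additive A -> A}) N w k :
  alt N (fun j => h (w j)) k = h (alt N w k).
Proof. by elim: N k => [|N IH] k /=; rewrite ?raddf0 // raddfB IH. Qed.

Lemma altB N w w' k :
  alt N (fun j => w j - w' j) k = alt N w k - alt N w' k.
Proof.
by elim: N k => [|N IH] k /=; rewrite ?subr0 // IH !opprD !opprK addrACA.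
Qed.

Lemma alt_unique N w z : supported N w -> supported N z ->
  (forall k, z k + z k.+2 = w k) -> alt N w =1 z.
Proof.
move=> w_supp z_supp zE k; apply/eqP; rewrite -subr_eq0; apply/eqP.
move: k; apply: (@add_shift2_eq0 N).
  by move=> k le_Nk; rewrite (alt_supported N w_supp) // z_supp ?subrr.
by move=> k; rewrite addrACA altK // -opprD zE subrr.
Qed.

(** The operator B = D (1 + D^2)^-1. *)
Definition step N z := alt N (fun k => z k.+1).

Lemma step_supported n N z : supported n.+1 z -> supported n (step N z).
Proof. by move=> z_supp; apply: alt_supported => k le_nk; apply: z_supp. Qed.

Lemma stepK N z k : supported N z -> step N z k + step N z k.+2 = z k.+1.
Proof. by move=> z_supp; apply: altK => j le_Nj; apply: z_supp; lia. Qed.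

(** The i-th coordinate of a sequence z is the value at 0 of B^i z. *)
Definition coord N z i := iter i (step N) z 0%N.

Lemma eq_iter_step N z z' i : z =1 z' -> iter i (step N) z =1 iter i (step N) z'.
Proof. by move=> E; elim: i => //= i IH k; apply: eq_alt => j; apply: IH. Qed.

Lemma coord_supported n N z : supported n z -> supported n (coord N z).
Proof.
move=> z_supp i le_ni.
suff: supported (n - i) (iter i (step N) z) by apply; lia.
elim: i {le_ni} => [|i IH] /=; first by rewrite subn0.
move=> k le_k; rewrite /step (@alt_supported (n - i.+1)) // => j le_j.
by apply: IH; lia.
Qed.

Lemma coord_map (h : {additive A -> A}) N z i :
  coord N (fun k => h (z k)) i = h (coord N z i).
Proof.
suff E k : iter i (step N) (fun k => h (z k)) k = h (iter i (step N) z k) by apply: E.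
elim: i k => //= i IH k; rewrite /step -alt_map.
by apply: eq_alt => j; rewrite IH.
Qed.

Lemma coordB N z z' i :
  coord N (fun k => z k - z' k) i = coord N z i - coord N z' i.
Proof.
suff E k : iter i (step N) (fun k => z k - z' k) k
             = iter i (step N) z k - iter i (step N) z' k by apply: E.
elim: i k => //= i IH k; rewrite /step -altB.
by apply: eq_alt => j; rewrite IH.
Qed.

Lemma coord_inj n N z : (n <= N)%N -> supported n z ->
  (forall i, coord N z i = 0) -> forall k, z k = 0.
Proof.
elim: n z => [|n IH] z le_nN z_supp z0; first by move=> k; apply: z_supp.
have Bz0 : forall k, step N z k = 0.
  apply: IH; [by lia | exact: step_supported|] => i.
  by rewrite /coord -iterSr; exact: (z0 i.+1).
case=> [|k]; first exact: (z0 0%N).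
by rewrite -(@stepK N) ?Bz0 ?addr0 //; apply: supported_le z_supp.
Qed.

(** A sequence z is rebuilt from z_0 and from z' = B z, since z_(k+1) = z'_k + z'_(k+2). *)
Lemma coord_surj n N x : (n <= N)%N -> supported n x ->
  exists2 z, supported n z & coord N z =1 x.
Proof.
elim: n x => [|n IH] x le_nN x_supp.
  exists (fun=> 0) => // i; rewrite x_supp //.
  by apply: (@coord_supported 0%N).
have [||z z_supp zE] := IH (fun i => x i.+1); first by lia.
  by move=> k le_nk; apply: x_supp.
exists (fun k => if k is k'.+1 then z k' + z k'.+2 else x 0%N).
  by case=> // k le_nk; rewrite !z_supp ?addr0 //; lia.
case=> // i; rewrite -zE /coord iterSr; apply: eq_iter_step.
apply: alt_unique => // k le_Nk; rewrite ?z_supp ?addr0 //; lia.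
Qed.

Variable s : {additive A -> A}.

(** The operator s stands for the sum of the two translates along Z/m.  The four systems
    below are the equations of the graph in four successive sets of unknowns; this is
    the last, triangular one. *)
Definition coord_system x :=
  x 0%N *+ 4 = 0 /\ forall i, s (x i) = x i.+1 *+ 4.

(** The equations for z; the second one reads s z = 4 B z. *)
Definition diff_system z :=
  z 0%N *+ 4 = 0 /\ forall k, s (z k + z k.+2) = z k.+1 *+ 4.

Lemma diff_system_coord N z :
  supported N z -> diff_system z <-> coord_system (coord N z).
Proof.
move=> z_supp; pose e k := s (z k) - step N z k *+ 4.
have Bz_supp : supported N (step N z).
  by apply: alt_supported => k le_Nk; apply: z_supp; lia.
have e_supp : supported N e.
  by move=> k le_Nk; rewrite /e z_supp // Bz_supp // mul0rn raddf0 subrr.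
have eE k : e k + e k.+2 = s (z k + z k.+2) - z k.+1 *+ 4.
  by rewrite addrACA -opprD -mulrnDl stepK // -(raddfD s).
have coord_e i : coord N e i = s (coord N z i) - coord N z i.+1 *+ 4.
  pose fourM := GRing.isZmodMorphism.Build A A _ (@mulrnBl A 4).
  pose four : {additive A -> A} := HB.pack (fun a : A => a *+ 4) fourM.
  by rewrite coordB (coord_map s) (coord_map four) /coord iterSr.
split=> -[z0 E]; split=> // k; apply/eqP; rewrite -subr_eq0.
  rewrite -coord_e; apply/eqP.
  have e0 : e =1 (fun=> 0).
    by apply: (add_shift2_eq0 e_supp) => j; rewrite eE E subrr.
  rewrite /coord (eq_iter_step N k e0).
  by apply: (@coord_supported 0%N).
(* All coordinates of s z - 4 B z vanish. *)
rewrite -eE; have e0 : forall k, e k = 0; last by rewrite !e0 addr0.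
by apply: (coord_inj (leqnn N)) => // i; rewrite coord_e E subrr.
Qed.

(** The equations for w, the columns read along the walk from its end. *)
Definition folded_system w :=
  s (w 0%N + w 1%N) = w 0%N *+ 4 /\ forall k, s (w k + w k.+2) = w k.+1 *+ 4.

(** The sequence z = (1 - D) (1 + D^2)^-1 w. *)
Definition diff_alt N w := alt N (fun k => w k - w k.+1).

Lemma diff_supported N w : supported N w -> supported N (fun k => w k - w k.+1).
Proof. by move=> w_supp k le_Nk; rewrite !w_supp ?subrr //; lia. Qed.

Lemma diff_altK N w k : supported N w ->
  diff_alt N w k + diff_alt N w k.+2 = w k - w k.+1.
Proof. by move=> w_supp; apply/altK/diff_supported. Qed.

Lemma diff_alt_supported N w : supported N w -> supported N (diff_alt N w).
Proof. by move=> w_supp; apply/alt_supported/diff_supported. Qed.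

Lemma diff_altB N w w' k :
  diff_alt N (fun j => w j - w' j) k = diff_alt N w k - diff_alt N w' k.
Proof.
rewrite -altB; apply: eq_alt => j.
by rewrite !opprD !opprK addrACA.
Qed.

Lemma diff_alt_inj N w : supported N w ->
  (forall k, diff_alt N w k = 0) -> forall k, w k = 0.
Proof.
move=> w_supp z0; apply: (descending_ind w_supp) => k IH.
have := diff_altK k w_supp; rewrite !z0 addr0 (IH k.+1) // subr0.
by move=> <-.
Qed.

Lemma diff_alt_surj N z : supported N z ->
  exists2 w, supported N w & diff_alt N w =1 z.
Proof.
move=> z_supp; pose w k := \sum_(k <= i < N) (z i + z i.+2).
have w_supp : supported N w by move=> k le_Nk; rewrite /w big_geq.
exists w => //; apply: alt_unique => //; first exact: diff_supported.
move=> k; have [le_Nk|lt_kN] := leqP N k.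
  by rewrite !w_supp ?z_supp ?subrr ?addr0 //; lia.
by rewrite /w big_ltn // addrK.
Qed.

Lemma folded_system_diff_alt N w :
  supported N w -> folded_system w <-> diff_system (diff_alt N w).
Proof.
move=> w_supp; set z := diff_alt N w.
have z_supp : supported N z by exact: diff_alt_supported.
have zE k : z k + z k.+2 = w k - w k.+1 by exact: diff_altK.
pose E k := s (w k + w k.+2) - w k.+1 *+ 4.
pose e k := s (z k + z k.+2) - z k.+1 *+ 4.
have E_supp : supported N E.
  by move=> k le_Nk; rewrite /E !w_supp ?addr0 ?raddf0 ?mul0rn ?subrr //; lia.
have e_supp : supported N e.
  by move=> k le_Nk; rewrite /e !z_supp ?addr0 ?raddf0 ?mul0rn ?subrr //; lia.
have EeE k : e k + e k.+2 = E k - E k.+1.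
  rewrite /e /E [RHS]subrACA -(raddfB s) -mulrnBl -!zE [LHS]addrACA -opprD.
  rewrite -(raddfD s) -mulrnDl; congr (s _ - _).
  by rewrite !zE opprD addrACA.
have E_e : (forall k, E k = 0) <-> (forall k, e k = 0).
  split=> H0.
    by apply: (add_shift2_eq0 e_supp) => k; rewrite EeE !H0 subrr.
  apply: (descending_ind E_supp) => k IH.
  have := EeE k; rewrite !H0 addr0 (IH k.+1) // subr0; exact/esym.
(* The boundary condition is F 0 = 0.  The sequence F + 4 z is constant, and it vanishes
   for large k. *)
pose F k := s (w k + w k.+1) - w k *+ 4.
have F_z : (forall k, e k = 0) -> forall k, F k + z k *+ 4 = 0.
  move=> e0; apply: (descending_ind (n := N)) => k.
    by move=> le_Nk; rewrite /F !w_supp ?z_supp ?(addr0, raddf0, mul0rn, subrr) //; lia.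
  move=> /(_ k.+1 (ltnSn k)) <-; apply/eqP; rewrite -subr_eq0.
  have sE j : s (z j + z j.+2) = z j.+1 *+ 4.
    by apply/eqP; rewrite -subr_eq0 -/(e j) e0.
  have -> : F k = s (w k.+1 + w k.+2) + (z k.+1 *+ 4 + z k.+2 *+ 4) - w k *+ 4.
    rewrite /F -!sE -!(raddfD s); congr (s _ - _).
    by rewrite !zE (subrKA (w k.+1)) [RHS]addrC [w k.+1 + w k.+2]addrC (subrKA (w k.+2)).
  have -> : w k = w k.+1 + (z k + z k.+2) by rewrite zE addrC subrK.
  rewrite /F !mulrnDl.
  move: (z k *+ 4) (z k.+1 *+ 4) (z k.+2 *+ 4) (w k.+1 *+ 4) (s _) => a b c d p.
  rewrite subr_eq0 !opprD !addrA [X in X + _ == _]addrAC subrK.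
  by rewrite [X in X == _]addrAC addrK addrAC.
split=> -[w0 wE].
  have e0 k : e k = 0 by apply E_e => j; rewrite /E wE subrr.
  split; last by move=> k; apply/eqP; rewrite -subr_eq0 -/(e k) e0.
  by have := F_z e0 0%N; rewrite /F w0 subrr add0r.
have e0 k : e k = 0 by rewrite /e wE subrr.
split; last by move=> k; apply/eqP; rewrite -subr_eq0 -/(E k) (E_e.2 e0).
by apply/eqP; rewrite -subr_eq0 -/(F 0%N) -[F _](addr0) -{1}w0 F_z.
Qed.

(** The equations for the columns u_0, ..., u_n of a harmonic function. *)
Definition column_system n (u : nat -> A) :=
  [/\ u 0%N = 0, s (u n) = 0
    & forall i, (i < n)%N -> s (u i.+1 + u i) = u (n - i)%N *+ 4].

(** The columns read along the walk from its end, extended by zero. *)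
Definition folded n (u : nat -> A) k := if (k <= n)%N then u (fold_index n k) else 0.

Lemma folded_unfold n u i : (i <= n)%N -> folded n u (unfold_index n i) = u i.
Proof. by move=> le_in; rewrite /folded unfold_index_le // unfold_indexK. Qed.

Lemma folded_supported n u : u 0%N = 0 -> supported n (folded n u).
Proof.
move=> u0 k le_nk; rewrite /folded; case: leqP => // le_kn.
suff -> : fold_index n k = 0%N by [].
by have := fold_indexP le_kn; lia.
Qed.

Lemma column_system_folded n u : (0 < n)%N -> u 0%N = 0 ->
  column_system n u <-> folded_system (folded n u).
Proof.
move=> n_gt0 u0; set w := folded n u.
have w_supp : supported n w by exact: folded_supported.
have w_last : w n.-1 = u n.
  by rewrite -(@folded_unfold n u n) //; congr w; have := unfold_indexP n n; lia.
have uE i : (i < n)%N -> s (u i.+1 + u i) = u (n - i)%N *+ 4 <->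
    s (w (unfold_index n i.+1) + w (unfold_index n i))
      = w (unfold_index n (n - i)) *+ 4.
  by move=> lt_in; rewrite /w !folded_unfold //; lia.
split=> [[_ un E]|[w0 wE]].
  have wE k : (k < n)%N -> exists2 i, (i < n)%N & unfold_index n (n - i) = k.
    move=> lt_kn; have := fold_index_lt lt_kn; have := fold_index_le (ltnW lt_kn).
    exists (n - fold_index n k)%N; first by lia.
    by rewrite subKn // fold_indexK // ltnW.
  split.
    have [i lt_in Ei] := wE _ n_gt0; have := E i lt_in; rewrite uE //.
    by have [] := unfold_neighbours lt_in; rewrite Ei; [|lia|lia] => -[_];
      case=> -[-> ->] => [|<-]; rewrite // addrC.
  move=> k; have [le_nk|lt_kn] := leqP n k.+1.
    rewrite (w_supp k.+1) // (w_supp k.+2) ?addr0 ?mul0rn; last by lia.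
    have [le_n_k|?] := leqP n k; first by rewrite w_supp ?raddf0.
    by rewrite (_ : k = n.-1) ?w_last //; lia.
  have [i lt_in Ei] := wE _ lt_kn; have := E i lt_in; rewrite uE //.
  by have [] := unfold_neighbours lt_in; rewrite Ei; [lia| |] => -[_ [-> ->]] //=;
    rewrite addrC.
split=> //.
  have := wE n.-1; rewrite prednK // (w_supp n.+1) // (w_supp n) // addr0 w_last.
  by rewrite mul0rn.
move=> i lt_in; rewrite uE //.
have [[-> [[-> ->]|[-> ->]]]|[k0 [-> ->]]|[k0 [-> ->]]] := unfold_neighbours lt_in.
- by [].
- by rewrite addrC.
- by rewrite addrC; have := wE (unfold_index n (n - i)).-1; rewrite prednK.
- by have := wE (unfold_index n (n - i)).-1; rewrite prednK.
Qed.

(** The change of unknowns that turns [column_system] into [coord_system]. *)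
Definition reduce n u := coord n (diff_alt n (folded n u)).

Lemma eq_reduce n u v : (forall i, (i <= n)%N -> u i = v i) -> reduce n u =1 reduce n v.
Proof.
move=> E k; apply: eq_iter_step => i; apply: eq_alt => j.
by rewrite /folded; do 2![case: leqP => ? //]; rewrite ?E // fold_index_le.
Qed.

Lemma reduceB n u v i :
  reduce n (fun j => u j - v j) i = reduce n u i - reduce n v i.
Proof.
rewrite -coordB; apply: eq_iter_step => k; rewrite -diff_altB.
by apply: eq_alt => j; rewrite /folded; do 2![case: leqP => ? //]; rewrite ?subr0.
Qed.

Lemma reduce_supported n u : u 0%N = 0 -> supported n (reduce n u).
Proof. by move=> u0; apply/coord_supported/diff_alt_supported/folded_supported. Qed.

Lemma reduce_system n u : (0 < n)%N -> u 0%N = 0 ->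
  column_system n u <-> coord_system (reduce n u).
Proof.
move=> n_gt0 u0; have w_supp : supported n (folded n u) := folded_supported u0.
apply: (iff_trans (column_system_folded n_gt0 u0)).
apply: (iff_trans (folded_system_diff_alt w_supp)).
exact: (diff_system_coord (diff_alt_supported w_supp)).
Qed.

Lemma reduce_inj n u : u 0%N = 0 -> (forall i, reduce n u i = 0) ->
  forall i, (i <= n)%N -> u i = 0.
Proof.
move=> u0 x0 i le_in; rewrite -(folded_unfold u le_in).
apply: (@diff_alt_inj n); first exact: folded_supported.
apply: (@coord_inj n n) => //; exact/diff_alt_supported/folded_supported.
Qed.

Lemma reduce_surj n x : supported n x ->
  exists2 u, u 0%N = 0 & reduce n u =1 x.
Proof.
move=> x_supp; have [z z_supp zE] := coord_surj (leqnn n) x_supp.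
have [w w_supp wE] := diff_alt_surj z_supp.
exists (fun i => w (unfold_index n i)).
  by apply: w_supp; rewrite /unfold_index /= subn0.
move=> i; rewrite -zE; apply: eq_iter_step => k; rewrite -wE.
apply: eq_alt => j; rewrite /folded.
have E l : (if (l <= n)%N then w (unfold_index n (fold_index n l)) else 0) = w l.
  by case: leqP => [le_ln|lt_nl]; rewrite ?fold_indexK // w_supp // ltnW.
by rewrite !E.
Qed.

End FiniteSequences.

(** * Periods of the recurrence *)

Lemma mulrn_dvd_eq0 (V : zmodType) (x : V) (a b : nat) :
  (a %| b)%N -> x *+ a = 0 -> x *+ b = 0.
Proof. by move=> /dvdnP[c ->] x0; rewrite mulnC mulrnA x0 mul0rn. Qed.

Lemma mulrn_gcd_eq0 (V : zmodType) (x : V) (a b : nat) :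
  x *+ a = 0 -> x *+ b = 0 -> x *+ gcdn a b = 0.
Proof.
move=> xa xb; have [->|a_gt0] := posnP a; first by rewrite gcd0n.
case: (egcdnP b a_gt0) => p q E _.
have : x *+ (p * a) = 0 by rewrite mulnC mulrnA xa mul0rn.
by rewrite E mulrnDr mulnC mulrnA xb mul0rn add0r.
Qed.

Lemma shift_dvd (T : Type) (f : nat -> T) (p q : nat) : (p %| q)%N ->
  (forall j, f (j + p)%N = f j) -> forall j, f (j + q)%N = f j.
Proof.
move=> /dvdnP[c ->] fp; elim: c => [|c IH] j; first by rewrite addn0.
by rewrite mulSn addnA IH fp.
Qed.

Lemma shift_gcd (T : Type) (f : nat -> T) (p q : nat) :
    (forall j, f (j + p)%N = f j) -> (forall j, f (j + q)%N = f j) ->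
  forall j, f (j + gcdn p q)%N = f j.
Proof.
move=> fp fq j; have [->|p_gt0] := posnP p; first by rewrite gcd0n.
case: (egcdnP q p_gt0) => a b E _.
rewrite -(shift_dvd (dvdn_mull b (dvdnn q)) fq) -addnA [(gcdn _ _ + _)%N]addnC -E.
by rewrite (shift_dvd (dvdn_mull a (dvdnn p)) fp).
Qed.

Section Recurrence.
Variables (M : zmodType).
Implicit Types (X Y : nat -> nat -> M) (n m k j e : nat).

(** Rows are indexed by k and positions along the unrolled circle by j. *)
Definition recurrent X :=
  forall k j, X k j.+2 + X k j = X k.+1 j.+1 *+ 4.

(** Only the rows of index below n may be nonzero. *)
Definition rows n X := forall k, (n <= k)%N -> forall j, X k j = 0.

Definition periodic p X := forall k j, X k (j + p)%N = X k j.

(** With S the passage to the next row and T the translation, this is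
    T^4 - 1 = 8 S T^2 (T - 2 S), a consequence of T^2 + 1 = 4 S T. *)
Lemma shift4 X k j : recurrent X ->
  X k j.+4 - X k j = X k.+1 j.+3 *+ 8 - X k.+2 j.+2 *+ 16.
Proof.
move=> X_rec; rewrite (mulrnA _ 4 4) -X_rec mulrnDl (mulrnDr _ 4 4).
by rewrite opprD addrA addrK -!X_rec addrKA.
Qed.

(** The period 4 gives 8 S T X = 16 S^2 X, and both sides vanish by descending
    induction on the row. *)
Lemma periodic4 n X : recurrent X -> rows n X ->
  periodic 4 X <-> forall k j, X k.+1 j *+ 8 = 0.
Proof.
move=> X_rec X_rows; split=> [X4|X8 k j]; last first.
  apply/eqP; rewrite -subr_eq0 addn4 shift4 // X8.
  by rewrite (mulrnA _ 8 2) X8 mul0rn subrr.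
apply: (descending_ind (n := n)) => [k le_nk j|k IH j].
  by rewrite X_rows ?mul0rn //; lia.
rewrite -X4 addn4; have := shift4 k j.+1 X_rec.
by rewrite -[j.+1.+4]addn4 X4 subrr (mulrnA _ 8 2) (IH k.+1) // mul0rn subr0 => <-.
Qed.

Definition difference N X k j := X k (j + N)%N - X k j.

Lemma difference_recurrent N X : recurrent X -> recurrent (difference N X).
Proof.
by move=> X_rec k j; rewrite /difference addrACA -opprD X_rec mulrnBl -!X_rec.
Qed.

Lemma difference_rows n N X : rows n X -> rows n (difference N X).
Proof. by move=> X_rows k le_nk j; rewrite /difference !X_rows ?subrr. Qed.

Lemma recurrent_mul2 X : recurrent X -> recurrent (fun k j => X k j *+ 2).
Proof. by move=> X_rec k j; rewrite -mulrnDl X_rec mulrnAC. Qed.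

Lemma rows_mul2 n X : rows n X -> rows n (fun k j => X k j *+ 2).
Proof. by move=> X_rows k le_nk j; rewrite X_rows ?mul0rn. Qed.

(** With N = 4 * 2^e and Y = (T^N - 1) X, the period 2 N means T^N Y = - Y.  In both
    directions this is the same as 2 Y = 0, that is as the period N of 2 X, because Y
    has period 4 as soon as 8 S Y = 0. *)
Lemma periodic_pow2 n X e : recurrent X -> rows n X ->
  periodic (4 * 2 ^ e) X <-> forall k j, X k.+1 j *+ (8 * 2 ^ e) = 0.
Proof.
elim: e X => [|e IH] X X_rec X_rows; first exact: (periodic4 X_rec X_rows).
set N := (4 * 2 ^ e)%N; set Y := difference N X.
have Y_rec : recurrent Y by exact: difference_recurrent.
have Y_rows : rows n Y by exact: difference_rows.
have N2 : (4 * 2 ^ e.+1 = N + N)%N by rewrite /N expnS; lia.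
have X2 := IH _ (recurrent_mul2 X_rec) (rows_mul2 X_rows).
have X2E k j : X k.+1 j *+ (8 * 2 ^ e.+1) = X k.+1 j *+ 2 *+ (8 * 2 ^ e).
  by rewrite -mulrnA expnS mulnCA.
have Y2E k j : Y k j *+ 2 = X k (j + N)%N *+ 2 - X k j *+ 2 by rewrite mulrnBl.
split=> [XN k j|X0].
  rewrite X2E; apply X2 => {k j} k j; apply/eqP; rewrite -subr_eq0 -Y2E; apply/eqP.
  (* If 2 Y vanishes in the rows after k, then row k of Y has period 4, hence N, so that
     it equals its opposite. *)
  move: k j; apply: (descending_ind (n := n)) => [k le_nk j|k IHk j].
    by rewrite Y_rows ?mul0rn.
  have Y4 i : Y k (i + 4)%N = Y k i.
    apply/eqP; rewrite -subr_eq0 addn4 shift4 // (mulrnA _ 2 4) (mulrnA _ 2 8).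
    by rewrite !IHk ?mul0rn ?subrr //; lia.
  have YN : Y k (j + N)%N = Y k j by apply: (shift_dvd _ Y4); exact: dvdn_mulr.
  rewrite mulr2n -{1}YN /Y /difference -addnA -N2 XN.
  by rewrite addrA subrK subrr.
have Y2 k j : Y k j *+ 2 = 0.
  by rewrite Y2E; apply/eqP; rewrite subr_eq0; apply/eqP; move: k j; apply X2 => k j;
    rewrite -X2E.
have Y4 : periodic 4 Y.
  by apply/(periodic4 Y_rec Y_rows) => k j; rewrite (mulrnA _ 2 4) Y2 mul0rn.
move=> k j; rewrite N2 addnA; apply/eqP; rewrite -subr_eq0.
have -> : X k (j + N + N)%N - X k j = Y k (j + N)%N + Y k j.
  by rewrite /Y /difference addrA subrK.
by rewrite (@shift_dvd _ (Y k) 4 N) ?dvdn_mulr // -mulr2n Y2.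
Qed.

(** The equations give 4^(k+1) X_k = 0 at every position j > 0, and the period carries
    this to j = 0. *)
Lemma periodic_torsion m X : (0 < m)%N -> recurrent X -> periodic m X ->
  (forall j, X 0%N j *+ 4 = 0) -> forall k j, X k j *+ 4 ^ k.+1 = 0.
Proof.
move=> m_gt0 X_rec Xm X0; elim=> [|k IH] j; first by rewrite expn1 X0.
rewrite -Xm -(prednK m_gt0) addnS expnS mulrnA -X_rec mulrnDl !IH; exact: addr0.
Qed.

(** Being killed by 4^n, the array has period 4 * 2^(2n). *)
Lemma periodic_gcd m n X : recurrent X -> rows n X ->
    (forall k j, X k j *+ 4 ^ n = 0) -> periodic m X ->
  periodic (gcdn m (4 * 2 ^ (2 * n))) X.
Proof.
move=> X_rec X_rows X_tor Xm k; apply: shift_gcd => //.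
move: k; apply/(periodic_pow2 _ X_rec X_rows) => k j.
by apply: mulrn_dvd_eq0 (X_tor _ _); rewrite expnM; exact: dvdn_mull.
Qed.

Lemma gcd_pow2 m e : (4 %| m)%N -> exists t, gcdn m (4 * 2 ^ e) = (4 * 2 ^ t)%N.
Proof.
move=> /dvdnP[c ->]; rewrite mulnC -muln_gcdr.
have /(@dvdn_pfactor 2)[//|t _ ->] := dvdn_gcdr c (2 ^ e).
by exists t.
Qed.

Lemma periodic_iff m n X : (4 %| m)%N -> recurrent X -> rows n X ->
    (forall k j, X k j *+ 4 ^ n = 0) ->
  periodic m X <-> forall k j, X k.+1 j *+ (2 * m) = 0.
Proof.
move=> m4 X_rec X_rows X_tor.
have [t gE] := gcd_pow2 (2 * n) m4.
have g2 : (8 * 2 ^ t = 2 * gcdn m (4 * 2 ^ (2 * n)))%N by rewrite gE; lia.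
split=> [Xm k j|X0 k].
  have := periodic_gcd X_rec X_rows X_tor Xm; rewrite gE.
  move=> /(periodic_pow2 _ X_rec X_rows)/(_ k j); apply: mulrn_dvd_eq0.
  by rewrite g2 dvdn_pmul2l // dvdn_gcdl.
apply: (shift_dvd (dvdn_gcdl m (4 * 2 ^ (2 * n)))); rewrite gE; move: k.
apply/(periodic_pow2 _ X_rec X_rows) => k j; rewrite g2 muln_gcdr.
apply: mulrn_gcd_eq0 => //; apply: mulrn_dvd_eq0 (X_tor _ _).
by rewrite expnM mulnA; exact: dvdn_mull.
Qed.

Lemma periodic2_mul2 n X : recurrent X -> rows n X -> periodic 2 X ->
  forall k j, X k j *+ 2 = 0.
Proof.
move=> X_rec X_rows X2; apply: (descending_ind (n := n)) => [k le_nk j|k IH j].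
  by rewrite X_rows ?mul0rn.
by rewrite mulr2n -{1}X2 addn2 X_rec (mulrnA _ 2 2) IH ?mul0rn.
Qed.

(** One step of the recurrence, acting on two consecutive columns of the array. *)
Definition advance (p : (nat -> M) * (nat -> M)) :=
  (p.2, fun k => p.2 k.+1 *+ 4 - p.1 k).

(** The solution of the recurrence with initial columns c0 and c1. *)
Definition solution (c0 c1 : nat -> M) k j := (iter j advance (c0, c1)).1 k.

Lemma solution_recurrent c0 c1 : recurrent (solution c0 c1).
Proof. by move=> k j; rewrite /solution /= subrK. Qed.

Lemma solution_ind (Q : nat -> M -> Prop) c0 c1 :
    (forall k a b, Q k.+1 a -> Q k b -> Q k (a *+ 4 - b)) ->
    (forall k, Q k (c0 k)) -> (forall k, Q k (c1 k)) ->
  forall k j, Q k (solution c0 c1 k j).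
Proof.
move=> Q_step Q0 Q1 k j; rewrite /solution.
suff [] : (forall k, Q k ((iter j advance (c0, c1)).1 k)) /\
          (forall k, Q k ((iter j advance (c0, c1)).2 k)) by move=> + _; apply.
by elim: j => //= j [IH1 IH2]; split=> // i; apply: Q_step.
Qed.

End Recurrence.

(** * Harmonic functions on CLF(m,n) *)

Section Laplacian.
Variables (m n : nat) (M : zmodType).
Implicit Types (u : {ffun vertex (CLF m n) -> M}) (j : 'I_m) (k : 'I_n.+1).

(** An interior vertex has four incident oriented edges, a boundary vertex only two. *)
Lemma Lstd_CLF u j k :
  Lstd u (j, k) =
    (u (j, k) - u (ordS j, rev_ord k)) + (u (j, k) - u (ord_pred j, rev_ord k))
    + (if unlift ord0 k is Some i then
         (u (j, k) - u (ordS j, lift ord0 (rev_ord i)))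
         + (u (j, k) - u (ord_pred j, lift ord0 (rev_ord i)))
       else 0).
Proof.
rewrite ffunE big_mkcond /=.
rewrite -(pair_bigA _ (fun (e : edge (CLF m n)) (b : bool) =>
  if ostart (e, b) == (j, k) then u (j, k) - u (oend (e, b)) else 0)) /=.
under eq_bigr do rewrite big_bool /=.
rewrite big_sumType /= addrC !big_split /=; congr (_ + _ + _).
- rewrite -big_mkcond (big_pred1 (j, k)) //.
  by case.
- rewrite -big_mkcond (big_pred1 (ord_pred j, rev_ord k)) //=.
  case=> a b /=; rewrite /ostart /= !xpair_eqE.
  by rewrite (can2_eq (@ordSK m) (@ord_predK m)) (can2_eq rev_ordK rev_ordK).
case: unliftP => [i ->|->].
  congr (_ + _).
    rewrite -big_mkcond (big_pred1 (j, i)) //=.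
    by case=> a b /=; rewrite /ostart /= !xpair_eqE (inj_eq lift_inj).
  rewrite -big_mkcond (big_pred1 (ord_pred j, rev_ord i)) //=.
  case=> a b /=; rewrite /ostart /= !xpair_eqE (inj_eq lift_inj).
  by rewrite (can2_eq (@ordSK m) (@ord_predK m)) (can2_eq rev_ordK rev_ordK).
by rewrite -big_split big1 //= => -[a b] _; rewrite /ostart /= !xpair_eqE
  ![lift _ _ == _]eq_sym !(negPf (neq_lift _ _)) !andbF addr0.
Qed.

(** The i-th column of u, for i <= n. *)
Definition column u (i : nat) : {ffun 'I_m -> M} := [ffun j => u (j, inord i)].

(** The sum of the two translates of a function on Z/m; for m = 1 both are f itself. *)
Definition neighbours (f : {ffun 'I_m -> M}) : {ffun 'I_m -> M} :=
  [ffun j => f (ordS j) + f (ord_pred j)].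

Fact neighbours_is_zmod_morphism : zmod_morphism neighbours.
Proof. by move=> f g; apply/ffunP => j; rewrite !ffunE addrACA -opprD. Qed.

HB.instance Definition _ :=
  GRing.isZmodMorphism.Build _ _ neighbours neighbours_is_zmod_morphism.

Lemma columnE u j k : u (j, k) = column u k j.
Proof. by rewrite ffunE inord_val. Qed.

Lemma columnB u v i : column (u - v) i = column u i - column v i.
Proof. by apply/ffunP => j; rewrite !ffunE. Qed.

Lemma Lstd_boundary u j :
  Lstd u (j, ord0) = column u 0 j *+ 2 - neighbours (column u n) j.
Proof.
rewrite Lstd_CLF unlift_none addr0 !columnE /= subSS subn0 !ffunE.
by rewrite addrACA -opprD mulr2n.
Qed.

Lemma Lstd_interior u j (i : 'I_n) :
  Lstd u (j, lift ord0 (rev_ord i)) =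
    column u (n - i) j *+ 4 - neighbours (column u i.+1 + column u i) j.
Proof.
rewrite Lstd_CLF liftK !columnE.
have -> : lift ord0 (rev_ord i) = (n - i)%N :> nat.
  by rewrite /= /bump /=; have := ltn_ord i; lia.
have -> : rev_ord (lift ord0 (rev_ord i)) = i :> nat.
  by rewrite /= /bump /=; have := ltn_ord i; lia.
have -> : lift ord0 (rev_ord (rev_ord i)) = i.+1 :> nat.
  by rewrite /= /bump /=; have := ltn_ord i; lia.
rewrite !ffunE [X in _ = _ - X]addrACA [X in _ = _ - X]addrC.
rewrite ![_ - _ + (_ - _)]addrACA -!opprD -!mulr2n [LHS]addrACA -opprD -mulr2n.
by rewrite -mulrnA.
Qed.

(** Column 0 is the boundary; the equations at its vertices say that the two translates
    of column n have sum zero. *)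
Lemma U0_column_system u : u \in @U0_pred _ M <-> column_system neighbours n (column u).
Proof.
split=> [/andP[/forallP Lu /forall_inP u0]|[u0 un uE]].
  have c0 : column u 0 = 0.
    apply/ffunP => j; rewrite [RHS]ffunE.
    by have := u0 (j, ord0); rewrite inE eqxx columnE => /(_ isT)/eqP.
  split=> // [|i lt_in]; apply/ffunP => j.
    have /eqP := Lu (j, ord0); rewrite Lstd_boundary c0 !ffunE mul0rn sub0r.
    by move/eqP; rewrite oppr_eq0 => /eqP.
  have /eqP := Lu (j, lift ord0 (rev_ord (Ordinal lt_in))).
  rewrite Lstd_interior => /eqP; rewrite subr_eq0 => /eqP /= <-.
  by rewrite ffunMnE.
apply/andP; split; last first.
  by apply/forall_inP => -[j k]; rewrite inE /= => /eqP ->; rewrite columnE u0 ffunE.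
apply/forallP => -[j k]; case: (unliftP ord0 k) => [i ->|->].
  by rewrite -(rev_ordK i) Lstd_interior uE ?ffunE ?subrr.
by rewrite Lstd_boundary u0 un !ffunE mul0rn subrr.
Qed.

Lemma column_inj u v :
  (forall i, (i <= n)%N -> column u i = column v i) -> u = v.
Proof. by move=> E; apply/ffunP => -[j k]; rewrite !columnE E // -ltnS. Qed.

Lemma column_surj (c : nat -> {ffun 'I_m -> M}) :
  exists u, forall i, (i <= n)%N -> column u i = c i.
Proof.
exists [ffun x : 'I_m * 'I_n.+1 => c x.2 x.1] => i le_in; apply/ffunP => j.
by rewrite !ffunE /= inordK.
Qed.

End Laplacian.

Section Unroll.
Variables (m : nat) (M : zmodType).
Implicit Types (x : nat -> {ffun 'I_m.+1 -> M}) (X : nat -> nat -> M).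

(** The array whose k-th row is x_k, a function on Z/(m+1), read periodically. *)
Definition unroll x k j := x k (inZp j).

Lemma inZp_ordS j : inZp j.+1 = ordS (inZp j : 'I_m.+1).
Proof. by apply: val_inj; rewrite /= -addn1 -modnDml addn1. Qed.

Lemma unroll_periodic x : periodic m.+1 (unroll x).
Proof.
by move=> k j; congr (x k _); apply: val_inj; rewrite /= modnDr.
Qed.

Lemma coord_system_unroll x : coord_system (@neighbours m.+1 M) x <->
  recurrent (unroll x) /\ (forall j, unroll x 0%N j *+ 4 = 0).
Proof.
have E k j : unroll x k j.+2 + unroll x k j = neighbours (x k) (inZp j.+1).
  by rewrite ffunE /unroll inZp_ordS [in ord_pred _]inZp_ordS ordSK.
split=> [[x0 xE]|[x_rec x0]].
  by split=> [k j|j]; [rewrite E xE ffunMnE|rewrite -ffunMnE x0 ffunE].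
split=> [|i]; apply/ffunP => j; rewrite ffunMnE.
  by rewrite ffunE -[j in LHS]valZpK; apply: x0.
have <- : inZp (ord_pred j).+1 = j by rewrite inZp_ordS valZpK ord_predK.
by rewrite -E; exact: x_rec.
Qed.

Lemma unroll_surj X : periodic m.+1 X ->
  exists x, forall k j, unroll x k j = X k j.
Proof.
move=> Xm; exists (fun k => [ffun j : 'I_m.+1 => X k j]) => k j.
rewrite /unroll ffunE /= [in RHS](divn_eq j m.+1) addnC.
by rewrite (shift_dvd (dvdn_mull (j %/ m.+1) (dvdnn m.+1)) (Xm k)).
Qed.

Lemma unroll_eq0 x k : (forall j, unroll x k j = 0) -> x k = 0.
Proof. by move=> x0; apply/ffunP => j; rewrite ffunE -[j]valZpK; apply: x0. Qed.

End Unroll.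

Section HarmonicRows.
Variables (m n : nat) (M : zmodType).
Hypothesis n_gt0 : (0 < n)%N.
Local Notation G := (CLF m.+1 n).

(** The array attached to a harmonic function.  By the lemmas below, U_0 is thereby the
    group of (m+1)-periodic solutions of the recurrence with n rows and 4 X_0 = 0. *)
Definition harmonic_row (u : U0 G M) : nat -> nat -> M :=
  unroll (reduce n (column (val u))).

Lemma harmonic_row_props u (X := harmonic_row u) :
  [/\ recurrent X, rows n X, forall j, X 0%N j *+ 4 = 0 & periodic m.+1 X].
Proof.
have /U0_column_system u_sys : val u \in @U0_pred G M := valP u.
have [u0 _ _] := u_sys.
have /(reduce_system _ n_gt0 u0)/coord_system_unroll[X_rec X0] := u_sys.
split=> //; last exact: unroll_periodic.
by move=> k le_nk j; rewrite /X /harmonic_row /unroll reduce_supported // ffunE.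
Qed.

Lemma harmonic_rowB u v k j :
  harmonic_row (u - v) k j = harmonic_row u k j - harmonic_row v k j.
Proof.
rewrite /harmonic_row /unroll.
have -> : reduce n (column (val (u - v))) k
    = reduce n (column (val u)) k - reduce n (column (val v)) k.
  by rewrite -reduceB; apply: eq_reduce => i _; rewrite raddfB columnB.
by rewrite !ffunE.
Qed.

Lemma harmonic_row_inj u :
  (forall k, harmonic_row u k 0%N = 0) -> (forall k, harmonic_row u k 1%N = 0) ->
  u = 0.
Proof.
move=> u_0 u_1; have [X_rec _ _ _] := harmonic_row_props u.
have X0 j : forall k, harmonic_row u k j = 0 /\ harmonic_row u k j.+1 = 0.
  elim: j => [|j IH] k; first by [].
  split; first by case: (IH k).
  have := X_rec k j; rewrite (IH k).1 (IH k.+1).2 mul0rn addr0; exact.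
have /U0_column_system[c0 _ _] : val u \in @U0_pred G M := valP u.
apply/val_inj/column_inj => i le_in.
rewrite (reduce_inj c0 _ le_in); first by apply/ffunP => j; rewrite !ffunE.
by move=> k; apply: unroll_eq0 => j; case: (X0 j k).
Qed.

Lemma harmonic_row_surj X :
    recurrent X -> rows n X -> (forall j, X 0%N j *+ 4 = 0) -> periodic m.+1 X ->
  exists u, forall k j, harmonic_row u k j = X k j.
Proof.
move=> X_rec X_rows X0 Xm; have [x xE] := unroll_surj Xm.
have x_supp : supported n x.
  by move=> k le_nk; apply: unroll_eq0 => j; rewrite xE X_rows.
have x_sys : coord_system (@neighbours m.+1 M) x.
  by apply/coord_system_unroll; split=> [k j|j]; rewrite !xE.
have [c c0 cE] := reduce_surj x_supp; have [u uE] := column_surj n c.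
have u0 : column u 0 = 0 by rewrite uE.
have rE : reduce n (column u) =1 x.
  by move=> k; rewrite -cE; apply: eq_reduce.
have u_sys : column_system (@neighbours m.+1 M) n (column u).
  by apply/(reduce_system _ n_gt0 u0); case: x_sys => x0 xE'; split=> [|i]; rewrite !rE.
have /U0_column_system Pu := u_sys.
exists (MkU0 Pu) => k j; rewrite -xE /harmonic_row /unroll /=.
by rewrite rE.
Qed.

End HarmonicRows.

(** * The three residue classes of m *)

Section Cases.
Variables (m n : nat).
Hypothesis n_gt0 : (0 < n)%N.
Local Notation U := (U0 (CLF m.+1 n) QZ).
Implicit Type u : U.

Lemma harmonic_row_torsion u k j : harmonic_row u k j *+ 4 ^ n = 0.
Proof.
have [X_rec X_rows X0 Xm] := harmonic_row_props n_gt0 u.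
have [le_nk|lt_kn] := leqP n k; first by rewrite X_rows ?mul0rn.
apply: (mulrn_dvd_eq0 _ (periodic_torsion (ltn0Sn m) X_rec Xm X0 k j)).
by rewrite dvdn_exp2l.
Qed.

Lemma harmonic_row_periodic_gcd u :
  periodic (gcdn m.+1 (4 * 2 ^ (2 * n))) (harmonic_row u).
Proof.
have [X_rec X_rows X0 Xm] := harmonic_row_props n_gt0 u.
exact: (periodic_gcd X_rec X_rows (harmonic_row_torsion u) Xm).
Qed.

Lemma harmonic_row_periodic1 u : odd m.+1 -> periodic 1 (harmonic_row u).
Proof.
move=> m_odd; have := harmonic_row_periodic_gcd u.
suff -> : gcdn m.+1 (4 * 2 ^ (2 * n)) = 1%N by [].
by apply/eqP; rewrite -[4%N]/(2 ^ 2)%N -expnD -/(coprime _ _) coprimeXr // coprimen2.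
Qed.

Lemma harmonic_row_periodic2 u : (m.+1 = 2 %[mod 4])%N -> periodic 2 (harmonic_row u).
Proof.
move=> m2 k; have := harmonic_row_periodic_gcd u.
suff -> : gcdn m.+1 (4 * 2 ^ (2 * n)) = 2%N by [].
have -> : m.+1 = (2 * (m.+1 %/ 4).*2.+1)%N by have := divn_eq m.+1 4; lia.
rewrite -[(4 * _)%N](mulnA 2 2) -muln_gcdr -expnS.
suff /eqP -> : coprime (m.+1 %/ 4).*2.+1 (2 ^ (2 * n).+1) by [].
by rewrite coprimeXr // coprimen2 /= odd_double.
Qed.

(** The extension by zero of a finite family. *)
Definition extend N (q : 'I_N -> QZ) (i : nat) : QZ :=
  if insub i is Some a then q a else 0.

Lemma extend_ord N (q : 'I_N -> QZ) (i : 'I_N) : extend q i = q i.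
Proof. by rewrite /extend valK. Qed.

Lemma extend_out N (q : 'I_N -> QZ) i : (N <= i)%N -> extend q i = 0.
Proof. by rewrite /extend => le_Ni; case: insubP => // a; lia. Qed.

Lemma extend_ind N (q : 'I_N -> QZ) (Q : nat -> QZ -> Prop) i :
  Q i 0 -> (forall a : 'I_N, Q a (q a)) -> Q i (extend q i).
Proof. by rewrite /extend => Q0 Qq; case: insubP => // a _ <-; apply: Qq. Qed.

Lemma isog_odd : odd m.+1 -> zmod_isog U {ffun 'I_n -> 'Z_2}.
Proof.
move=> m_odd.
apply: (@isog_coord U {ffun 'I_n -> 'Z_2} 'I_n (fun=> 2%N)
  (fun u k => harmonic_row u k 0) (fun k w => w k)) => //.
- by move=> u v k; exact: harmonic_rowB.
- move=> u u0; have [_ X_rows _ _] := harmonic_row_props n_gt0 u.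
  have X1 := harmonic_row_periodic1 u m_odd.
  have X0 k : harmonic_row u k 0%N = 0.
    by have [/X_rows//|lt_kn] := leqP n k; exact: (u0 (Ordinal lt_kn)).
  by apply: (harmonic_row_inj n_gt0) => // k; rewrite -(X0 k); exact: (X1 k 0%N).
- move=> u k; have [X_rec X_rows _ _] := harmonic_row_props n_gt0 u.
  apply: (periodic2_mul2 X_rec X_rows) => l j.
  exact: (shift_dvd (dvd1n 2) (harmonic_row_periodic1 u m_odd l)).
- move=> q q2; have e2 k : extend q k *+ 2 = 0.
    by apply: (@extend_ind _ q (fun _ a => a *+ 2 = 0)); rewrite ?mul0rn.
  have [|||//|u uE] := @harmonic_row_surj m n QZ n_gt0 (fun k _ => extend q k).
  + by move=> k j; rewrite -mulr2n (mulrnA _ 2 2) !e2 mul0rn.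
  + by move=> k le_nk j; exact: extend_out.
  + by move=> j; rewrite (mulrnA _ 2 2) !e2 mul0rn.
  by exists u => k; rewrite uE extend_ord.
- by move=> u v k; rewrite !ffunE.
- by move=> w w0; apply/ffunP => k; rewrite w0 ffunE.
- by move=> c; exists [ffun k => c k] => k; rewrite ffunE.
Qed.

Lemma isog_2mod4 :
  (m.+1 = 2 %[mod 4])%N -> zmod_isog U {ffun 'I_(2 * n) -> 'Z_2}.
Proof.
move=> m2.
apply: (@isog_coord U {ffun 'I_(2 * n) -> 'Z_2} 'I_(2 * n) (fun=> 2%N)
  (fun u i => harmonic_row u i./2 (odd i)) (fun k w => w k)) => //.
- by move=> u v i; exact: harmonic_rowB.
- move=> u u0; have [_ X_rows _ _] := harmonic_row_props n_gt0 u.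
  have X0 (b : bool) k : harmonic_row u k b = 0.
    have [/X_rows//|lt_kn] := leqP n k.
    have lt_i : (b + k.*2 < 2 * n)%N by case: b; lia.
    by have := u0 (Ordinal lt_i); rewrite /= half_bit_double oddD odd_double addbF oddb.
  by apply: (harmonic_row_inj n_gt0) => // k; [exact: (X0 false)|exact: (X0 true)].
- move=> u i; have [X_rec X_rows _ _] := harmonic_row_props n_gt0 u.
  exact: (periodic2_mul2 X_rec X_rows (harmonic_row_periodic2 u m2)).
- move=> q q2; have e2 k : extend q k *+ 2 = 0.
    by apply: (@extend_ind _ q (fun _ a => a *+ 2 = 0)); rewrite ?mul0rn.
  have [||||u uE] := @harmonic_row_surj m n QZ n_gt0
    (fun k j => extend q (odd j + k.*2)%N).
  + by move=> k j; rewrite /= negbK -mulr2n (mulrnA _ 2 2) !e2 mul0rn.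
  + by move=> k le_nk j; apply: extend_out; lia.
  + by move=> j; rewrite (mulrnA _ 2 2) !e2 mul0rn.
  + by move=> k j; rewrite oddD (_ : odd m.+1 = false) ?addbF //; lia.
  by exists u => i; rewrite uE oddb odd_double_half extend_ord.
- by move=> u v k; rewrite !ffunE.
- by move=> w w0; apply/ffunP => k; rewrite w0 ffunE.
- by move=> c; exists [ffun k => c k] => k; rewrite ffunE.
Qed.

Lemma isog_0mod4 : (m.+1 = 0 %[mod 4])%N ->
  zmod_isog U {ffun 'I_2 -> dirsum (fun j : 'I_n => 'Z_(gcdn (4 ^ j.+1) (2 * m.+1)))}.
Proof.
move=> m4; have m4' : (4 %| m.+1)%N by apply/eqP.
pose d (i : 'I_2 * 'I_n) := gcdn (4 ^ i.2.+1) (2 * m.+1).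
apply: (@isog_coord U {ffun 'I_2 -> dirsum (fun j : 'I_n => 'Z_(gcdn (4 ^ j.+1) (2 * m.+1)))}
  ('I_2 * 'I_n)%type d (fun u i => harmonic_row u i.2 i.1)
  (fun i w => w i.1 i.2)) => //.
(* The factor is nontrivial since 4 divides both 4^(k+1) and 2 (m+1). *)
- case=> b k; apply: (@leq_trans 4) => //; apply: dvdn_leq.
    by rewrite gcdn_gt0 muln_gt0 orbT.
  by rewrite dvdn_gcd (dvdn_exp2l 4 (_ : 1 <= k.+1)%N) ?dvdn_mull.
- by move=> u v [b k]; exact: harmonic_rowB.
- move=> u u0; have [_ X_rows _ _] := harmonic_row_props n_gt0 u.
  have X0 (b : 'I_2) k : harmonic_row u k b = 0.
    by have [/X_rows//|lt_kn] := leqP n k; exact: (u0 (b, Ordinal lt_kn)).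
  by apply: (harmonic_row_inj n_gt0) => // k; [exact: (X0 ord0)|exact: (X0 ord_max)].
- move=> u [b k]; have [X_rec X_rows X0 Xm] := harmonic_row_props n_gt0 u.
  apply: mulrn_gcd_eq0; first exact: (periodic_torsion (ltn0Sn m) X_rec Xm X0).
  have /(periodic_iff m4' X_rec X_rows (harmonic_row_torsion u)) X2 := Xm.
  (* The criterion says nothing about row 0, but 4 divides 2 (m+1). *)
  case: k => -[|k] lt_kn /=; last exact: X2.
  by apply: mulrn_dvd_eq0 (X0 _); exact: dvdn_mull.
- move=> q q_tor.
  (* Conditions on the entries of row k that the recurrence preserves. *)
  pose Q k (a : QZ) := [/\ (n <= k)%N -> a = 0, a *+ 4 ^ k.+1 = 0
                        & (0 < k)%N -> a *+ (2 * m.+1) = 0].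
  pose c (b : 'I_2) := extend (fun k => q (b, k)).
  have Qc b k : Q k (c b k).
    apply: extend_ind => [|a]; first by split; rewrite ?mul0rn.
    split; first by have := ltn_ord a; lia.
      by apply: mulrn_dvd_eq0 (q_tor (b, a)); exact: dvdn_gcdl.
    by move=> _; apply: mulrn_dvd_eq0 (q_tor (b, a)); exact: dvdn_gcdr.
  have QX : forall k j, Q k (solution (c ord0) (c ord_max) k j).
    apply: solution_ind => // k a e [a0 a4 a2] [e0 e4 e2]; split.
    + by move=> le_nk; rewrite a0 ?e0 ?mul0rn ?subrr // leqW.
    + by rewrite mulrnBl -mulrnA -expnS a4 e4 subrr.
    + by move=> k_gt0; rewrite mulrnBl e2 // mulrnAC a2 // mul0rn subrr.
  set X := solution _ _ in QX.
  have X_rec : recurrent X by exact: solution_recurrent.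
  have X_rows : rows n X by move=> k le_nk j; have [-> ] := QX k j.
  have X_tor k j : X k j *+ 4 ^ n = 0.
    have [le_nk|lt_kn] := leqP n k; first by rewrite X_rows ?mul0rn.
    by have [_ X4 _] := QX k j; apply: mulrn_dvd_eq0 X4; rewrite dvdn_exp2l.
  have [||u uE] := harmonic_row_surj n_gt0 X_rec X_rows (m := m).
  + by move=> j; case: (QX 0%N j).
  + apply/(periodic_iff m4' X_rec X_rows X_tor) => k j.
    by have [_ _ ->] := QX k.+1 j.
  exists u => -[b k]; rewrite uE /=.
  have [->|->] : b = ord0 \/ b = ord_max.
    by case: b => -[|[|//]] ?; [left|right]; apply: val_inj.
  + by rewrite /X /solution /= /c extend_ord.
  + by rewrite /X /solution /= /c extend_ord.
- by move=> u v [b k]; rewrite /= !ffunE.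
- by move=> w w0; apply/ffunP => b; apply/ffunP => k; rewrite (w0 (b, k)) !ffunE.
- by move=> c; exists [ffun b => [ffun k => c (b, k)]] => -[b k]; rewrite /= !ffunE.
Qed.

End Cases.

Local Close Scope ring_scope.

Theorem theorem3p1 (m n : nat) (hm : 1 <= m) (hn : 1 <= n) :
  [/\ odd m ->
        zmod_isog (U0 (CLF m n) QZ) {ffun 'I_n -> 'Z_2},
      m = 2 %[mod 4] ->
        zmod_isog (U0 (CLF m n) QZ) {ffun 'I_(2 * n) -> 'Z_2}
    & m = 0 %[mod 4] ->
        zmod_isog (U0 (CLF m n) QZ)
          {ffun 'I_2 -> dirsum (fun j : 'I_n => 'Z_(gcdn (4 ^ j.+1) (2 * m)))}].
Proof.
case: m hm => // m _; split.
- exact: isog_odd.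
- exact: isog_2mod4.
- exact: isog_0mod4.
Qed.
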